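(* Fix an integer $k\ge 3$ and let $A_n,\bar A_n$ ($n\ge 1$) be the antiregular $k$-hypergraphs defined in the context. Then for every $n\ge1$ the independence polynomials $I(A_n;x)$ and $I(\bar A_n;x)$ are log-concave.
   Context: All hypergraphs are $k$-uniform. For a binary string $b=b_1\cdots b_n$, let $H(b)$ be the $k$-uniform hypergraph on $\{1,\dots,n\}$ in which a $k$-subset is a hyperedge iff its largest element $j$ satisfies $b_j=1$ (vertex $j$ is added as isolated if $b_j=0$, and as dominating, forming a hyperedge with every $(k-1)$-subset of earlier vertices, if $b_j=1$). For $1\le n\le k-1$, $A_n=\bar A_n$ is the edgeless hypergraph on $n$ vertices; for $n\ge k$, $A_n=H(b)$ with $b$ of length $n$, $b_1=\dots=b_{k-1}=0$, $b_k,\dots,b_n$ alternating and $b_n=1$, and $\bar A_n$ is the same with $b_n=0$. A vertex set is independent if it contains no hyperedge, and $I(H;x)=\sum_{W\text{ independent}}x^{|W|}$. A polynomial $\sum_{i=0}^m a_ix^i$ of degree $m$ is log-concave if $a_i^2\ge a_{i-1}a_{i+1}$ for all $1\le i\le m-1$. *)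

(* Defs.v *)
From mathcomp Require Import all_boot all_order all_algebra.

Set Implicit Arguments.
Unset Strict Implicit.
Unset Printing Implicit Defensive.

Import Order.TTheory GRing.Theory Num.Theory.
Local Open Scope ring_scope.

(* A hypergraph on the finite type T is identified with its set of hyperedges. *)

Definition uniform (T : finType) (k : nat) (E : {set {set T}}) : Prop :=
  forall e : {set T}, e \in E -> #|e| = k.

Definition independent (T : finType) (E : {set {set T}}) (W : {set T}) : bool :=
  [forall e in E, ~~ (e \subset W)].

Definition indep_poly (T : finType) (E : {set {set T}}) : {poly int} :=
  \sum_(W : {set T} | independent E W) 'X^#|W|.

(* Vertices are numbered from 0: vertex j of {1, ..., n} is the ordinal j - 1, and
   its bit b_j is tnth b (j - 1). *)
Definition string_hypergraph (k n : nat) (b : n.-tuple bool) :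
    {set {set 'I_n}} :=
  [set e : {set 'I_n} | (#|e| == k) &&
     [exists j in e, [forall i in e, (i <= j)%N] && tnth b j]].

Lemma string_hypergraph_uniform (k n : nat) (b : n.-tuple bool) :
  uniform k (string_hypergraph k b).
Proof. by move=> e; rewrite inE => /andP[/eqP]. Qed.

(* The length n string with b_1 = ... = b_(k-1) = 0 and b_k, ..., b_n alternating
   with b_n = last; i is 0-based, so the position in 1..n is i.+1, and the bit
   there differs from b_n exactly when n - i.+1 is odd. *)
Definition antiregular_string (k n : nat) (last : bool) : n.-tuple bool :=
  [tuple (k <= i.+1)%N && (last (+) odd (n - i.+1)) | i < n].

Definition antiregular_gen (k n : nat) (last : bool) : {set {set 'I_n}} :=
  if (n < k)%N then set0 else string_hypergraph k (antiregular_string k n last).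

Definition antiregular (k n : nat) := antiregular_gen k n true.
Definition antiregular_bar (k n : nat) := antiregular_gen k n false.

(* The degree m of p is (size p).-1; the range of i is 1 <= i <= m - 1. *)
Definition log_concave (p : {poly int}) : Prop :=
  forall i : nat, (1 <= i)%N -> (i <= (size p).-1 - 1)%N ->
    p`_(i.-1) * p`_(i.+1) <= p`_i ^+ 2.

(* Main.v *)
(* Let [a_i] count the independent [i]-sets.  An isolated vertex multiplies the
   polynomial by [1 + x], which preserves log-concavity; a dominating vertex replaces
   [a_i] by ['C(n, i)] for [i < k] and leaves [a_i] alone for [i >= k].  Hence the only
   critical inequality is [a_k ^ 2 >= 'C(n, k-1) * a_(k+1)] when vertex [n] is
   dominating.  With [u_t = 'C(n-2-2t, k-1)] one has [a_k = \sum_(t >= 0) u_t] and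
   [a_(k+1) = \sum_(t >= 0) t * u_t], so the inequality is an equality for geometric
   [u] and in general follows from the log-concavity of [u]: the ratio
   [a_k / 'C(n, k-1)] increases with [n], and both facts propagate together by
   induction. *)
Require Import Defs.
From mathcomp Require Import all_boot all_order all_algebra.
From mathcomp Require Import zify.

Set Implicit Arguments.
Unset Strict Implicit.
Unset Printing Implicit Defensive.

Import GRing.Theory Num.Theory.

(** * Counting independent sets by a recursion on the last vertex *)

(* Here [k = r.+1]; the summand accounts for the sets that contain the last vertex. *)
Fixpoint indep_count (r : nat) (b : nat -> bool) (n i : nat) : nat :=
  match n, i with
  | _, 0 => 1
  | 0, _.+1 => 0
  | n'.+1, i'.+1 =>
      indep_count r b n' i'.+1 + (~~ b n' || (i' < r)) * indep_count r b n' i'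
  end.

Definition sparse_below (r : nat) (b : nat -> bool) (n : nat)
    (W : {set 'I_n}) : bool :=
  [forall j in W, b j ==> (#|[set i in W | i < j]| < r)].

(** A dominating [j] in [W] with at least [r] smaller members tops a hyperedge made of [j] and any
    [r] of them; conversely, the top of a hyperedge inside [W] has [r] smaller members. *)
Lemma independent_stringE (r n : nat) (b : nat -> bool) (W : {set 'I_n}) :
  independent (string_hypergraph r.+1 [tuple b i | i < n]) W
    = sparse_below r b W.
Proof.
apply/forall_inP/forall_inP => [indW j jW|spW e].
  apply/implyP => bj; rewrite ltnNge; apply/negP => le_r.
  have: 0 < #|[set A : {set 'I_n} | A \subset [set i in W | i < j] & #|A| == r]|.
    by rewrite cards_draws bin_gt0.
  case/card_gt0P => A; rewrite inE => /andP[/subsetP sAW /eqP cA].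
  have jA : j \notin A by apply/negP => /sAW; rewrite inE ltnn andbF.
  have /indW/negP : j |: A \in string_hypergraph r.+1 [tuple b i | i < n].
    rewrite inE cardsU1 jA cA eqxx /=; apply/existsP; exists j.
    rewrite setU11 tnth_mktuple bj andbT; apply/forall_inP => i.
    by rewrite !inE => /orP[/eqP->//|/sAW]; rewrite inE => /andP[_ /ltnW].
  case; apply/subsetP => i; rewrite !inE => /orP[/eqP->//|/sAW].
  by rewrite inE => /andP[].
rewrite inE => /andP[/eqP ce /existsP[j /and3P[je /forall_inP maxj]]].
rewrite tnth_mktuple => bj; apply/negP => /subsetP seW.
have /implyP/(_ bj) := spW j (seW j je); apply/negP; rewrite -leqNgt.
have -> : r = #|e :\ j| by move: ce; rewrite (cardsD1 j) je => -[].
apply/subset_leq_card/subsetP => i; rewrite !inE => /andP[nij ie].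
by rewrite seW // ltn_neqAle maxj // andbT.
Qed.

Lemma sum_set_ordS (n : nat) (F : {set 'I_n.+1} -> nat) :
  \sum_(W : {set 'I_n.+1}) F W =
  \sum_(W : {set 'I_n}) (F (lift ord_max @: W) + F (ord_max |: lift ord_max @: W)).
Proof.
pose h (p : bool * {set 'I_n}) : {set 'I_n.+1} :=
  if p.1 then ord_max |: lift ord_max @: p.2 else lift ord_max @: p.2.
pose g (W : {set 'I_n.+1}) := (ord_max \in W, lift ord_max @^-1: W).
have maxF (W : {set 'I_n}) : ord_max \in lift ord_max @: W = false.
  by apply/negP => /imsetP[i _ /eqP]; apply/negP; apply: neq_lift.
have hK : cancel h g.
  move=> [[] W]; rewrite /h /g /= ?setU11 ?maxF; congr pair; apply/setP => i;
    rewrite !inE (mem_imset _ _ (@lift_inj _ _)) //.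
  by rewrite eq_sym (negPf (neq_lift _ _)).
have gK : cancel g h.
  move=> W; apply/setP => i; rewrite /h /g /=.
  case: (unliftP ord_max i) => [j|] ->; case: ifP => maxW.
  - by rewrite !inE (mem_imset _ _ (@lift_inj _ _)) inE eq_sym (negPf (neq_lift _ _)).
  - by rewrite (mem_imset _ _ (@lift_inj _ _)) inE.
  - by rewrite setU11.
  - by rewrite maxF.
rewrite (reindex h) /=; last by exists g => x _; rewrite ?hK ?gK.
rewrite -(pair_bigA _ (fun x W => F (h (x, W)))) /= big_bool /= addnC big_split.
by [].
Qed.

(** The last vertex lies below no other, so including it leaves the condition at every older vertex
    unchanged. *)
Lemma card_lift_below (n : nat) (W : {set 'I_n}) (j : 'I_n) (x : bool) :
  #|[set i in (if x then ord_max |: lift ord_max @: W else lift ord_max @: W)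
     | i < lift ord_max j]| = #|[set i in W | i < j]|.
Proof.
rewrite -(card_imset (mem [set i in W | i < j]) (@lift_inj _ ord_max)).
apply: eq_card => i; apply/idP/imsetP => [|[i']].
  rewrite inE lift_max => /andP[iW lt_ij]; case: (unliftP ord_max i) iW lt_ij.
    move=> i' -> iW; rewrite lift_max => lt_ij; exists i' => //.
    rewrite inE lt_ij andbT; move: iW; case: x.
      by rewrite !inE eq_sym (negPf (neq_lift _ _)) (mem_imset _ _ (@lift_inj _ _)).
    by rewrite (mem_imset _ _ (@lift_inj _ _)).
  by move=> -> _ /=; rewrite ltnNge (ltnW (ltn_ord j)).
rewrite !inE => /andP[iW lt_ij] ->; rewrite !lift_max lt_ij andbT.
by case: x; rewrite ?inE (mem_imset _ _ (@lift_inj _ _)) // iW orbT.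
Qed.

Lemma sparse_below_lift (r n : nat) (b : nat -> bool) (W : {set 'I_n}) :
  sparse_below r b (lift ord_max @: W) = sparse_below r b W.
Proof.
apply/forall_inP/forall_inP => [spW j jW|spW _ /imsetP[j jW ->]].
  have := spW _ (imset_f (lift ord_max) jW).
  by rewrite (card_lift_below W j false) lift_max.
by rewrite (card_lift_below W j false) lift_max; apply: spW.
Qed.

Lemma sparse_below_max (r n : nat) (b : nat -> bool) (W : {set 'I_n}) :
  sparse_below r b (ord_max |: lift ord_max @: W)
    = sparse_below r b W && (~~ b n || (#|W| < r)).
Proof.
have cmax : #|[set i in ord_max |: lift ord_max @: W | i < @ord_max n]| = #|W|.
  rewrite -[RHS](card_imset (mem W) (@lift_inj _ ord_max)).
  apply: eq_card => i; rewrite !inE.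
  case: eqVneq => [->|ne_i] /=.
    rewrite ltnn; apply/esym/negP => /imsetP[j _ /eqP].
    by apply/negP; apply: neq_lift.
  by rewrite ltn_neqAle ne_i -ltnS ltn_ord !andbT.
rewrite -implybE; apply/forall_inP/andP => [spW|[/forall_inP spW bW] j].
  split; last by have := spW _ (setU11 _ _); rewrite cmax.
  apply/forall_inP => j jW.
  have := spW _ (setU1r _ (imset_f (lift ord_max) jW)).
  by rewrite (card_lift_below W j true) lift_max.
rewrite in_setU1 => /orP[/eqP->|/imsetP[i iW ->]]; first by rewrite cmax.
by rewrite (card_lift_below W i true) lift_max; apply: spW.
Qed.

Lemma card_sparse_below (r : nat) (b : nat -> bool) (n i : nat) :
  \sum_(W : {set 'I_n}) (sparse_below r b W && (#|W| == i) : nat)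
    = indep_count r b n i.
Proof.
elim: n i => [|n IHn] i.
  rewrite (bigD1 set0) //= big1 => [|W]; last first.
    by case/negP; apply/eqP/setP => -[].
  rewrite cards0 addn0; have -> : sparse_below r b (set0 : {set 'I_0}).
    by apply/forall_inP => -[].
  by case: i.
rewrite sum_set_ordS.
have cU (W : {set 'I_n}) : #|ord_max |: lift ord_max @: W| = #|W|.+1.
  rewrite cardsU1 (card_imset _ (@lift_inj _ _)).
  case: imsetP => [[j _ /eqP]|//].
  by rewrite (negPf (neq_lift _ _)).
under eq_bigr => W _ do
  rewrite sparse_below_lift sparse_below_max cU (card_imset _ (@lift_inj _ _)).
rewrite big_split /= IHn; case: i => [|i].
  by rewrite big1 ?addn0 => [|W _]; rewrite ?andbF //; case: n {IHn cU}.
rewrite /=; congr addn; rewrite -IHn big_distrr /=; apply: eq_bigr => W _.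
rewrite eqSS; case: eqP => [->|_]; last by rewrite !andbF muln0.
by rewrite !andbT mulnC mulnb.
Qed.

Lemma coef_indep_poly_string (r n : nat) (b : nat -> bool) (i : nat) :
  ((indep_poly (string_hypergraph r.+1 [tuple b j | j < n]))`_i
    = (indep_count r b n i)%:R)%R.
Proof.
rewrite /indep_poly coef_sum -card_sparse_below natr_sum big_mkcond /=.
apply: eq_bigr => W _; rewrite independent_stringE.
by case: sparse_below; rewrite // coefXn eq_sym.
Qed.

(** * Log-concave sequences and binomial inequalities *)

(* Absence of internal zeros is what makes log-concavity stable under
   multiplication of the generating polynomial by [1 + x]. *)
Definition lc_seq (f : nat -> nat) : Prop :=
  (forall i, f i * f i.+2 <= f i.+1 ^ 2) /\ (forall i, f i = 0 -> f i.+1 = 0).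

Lemma lc_seq_gap (f : nat -> nat) (i : nat) :
  lc_seq f -> f i * f i.+3 <= f i.+1 * f i.+2.
Proof.
move=> [lcf zf]; have := lcf i; have := lcf i.+1.
have := zf i.+1; have := zf i.+2.
move: (f i) (f i.+1) (f i.+2) (f i.+3) => A B C D zC zB le1 le2.
case: (posnP B) => [/zB/zC->|B_gt0]; first by rewrite muln0.
case: (posnP C) => [/zC->|C_gt0]; first by rewrite muln0.
(* The product of two consecutive log-concavity inequalities is the claim multiplied by [B * C]. *)
rewrite -(@leq_pmul2r (B * C)) ?muln_gt0 ?B_gt0 //.
have := leq_mul le2 le1; congr leq; nia.
Qed.

Lemma lc_seq_mul1X (f g : nat -> nat) :
    g 0 = f 0 -> (forall i, g i.+1 = f i.+1 + f i) ->
  lc_seq f -> lc_seq g.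
Proof.
move=> g0 gS lcf; split.
  case=> [|i]; rewrite !gS ?g0.
    have := lcf.1 0; have := lcf.1 1; nia.
  (* After expansion, the two squares absorb [f i.+1 * f i.+3] and [f i * f i.+2], and the gap
     inequality handles [f i * f i.+3]. *)
  have := lcf.1 i; have := lcf.1 i.+1; have := lc_seq_gap i lcf; nia.
case=> [|i]; rewrite !gS ?g0.
  by move=> f0; rewrite (lcf.2 0) ?f0.
move=> /eqP; rewrite addn_eq0 => /andP[/eqP f1 _].
by rewrite (lcf.2 _ f1) f1.
Qed.

Lemma lc_seq_bin (n : nat) : lc_seq (fun i => 'C(n, i)).
Proof.
elim: n => [|n IHn]; last by apply: lc_seq_mul1X IHn => //; rewrite !bin0.
by split=> -[|i]; rewrite !bin0n.
Qed.

Lemma bin_upper_lc2 (n r : nat) : 'C(n, r) * 'C(n.+4, r) <= 'C(n.+2, r) ^ 2.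
Proof.
case: (ltnP n r) => [/bin_small->//|/subnKC <-]; move: (n - r) => d {n}.
have down m : (r + m).+1 * 'C(r + m, r) = m.+1 * 'C((r + m).+1, r).
  by rewrite (mul_bin_down (r + m).+1) subSn ?leq_addr // addKn.
have down2 m : m.+1 * m.+2 * 'C((r + m).+2, r)
    = (r + m).+1 * (r + m).+2 * 'C(r + m, r).
  have := down m.+1; rewrite addnS => down1.
  by rewrite -mulnA -down1 mulnCA -down mulnCA mulnA.
have := down2 d; have := down2 d.+2; rewrite !addnS.
move: 'C(r + d, r) 'C((r + d).+2, r) 'C((r + d).+4, r) => c0 c2 c4 E4 E0.
rewrite -(@leq_pmul2l ((r + d).+1 * (r + d).+2 * (d.+3 * d.+4))) //.
have -> : (r + d).+1 * (r + d).+2 * (d.+3 * d.+4) * (c0 * c4)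
    = (d.+1 * (r + d).+3) * (d.+2 * (r + d).+4) * c2 ^ 2.
  transitivity ((r + d).+1 * (r + d).+2 * c0 * (d.+3 * d.+4 * c4)); first by lia.
  by rewrite -E0 E4; lia.
(* The ratios of consecutive terms are now explicit; paired as below, the factors differ by [2 * r]
   each. *)
rewrite leq_mul2r; apply/orP; right.
have -> : (r + d).+1 * (r + d).+2 * (d.+3 * d.+4)
    = ((r + d).+1 * d.+3) * ((r + d).+2 * d.+4) by lia.
by apply: leq_mul; lia.
Qed.

(** Here [a], [b] are the counts at [r.+1], [r.+2], and [c], [c2] stand for ['C(n, r)],
    ['C(n.+2, r)]; an isolated vertex turns [a], [b] into [a + c], [b + a]. Both sides are compared
    through [c2 * a * (a + c)]. *)
Lemma geometric_step_count (a b c c2 : nat) :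
    0 < c -> c * b <= a ^ 2 -> c2 * a <= c ^ 2 + c * a ->
  c2 * (b + a) <= (a + c) ^ 2.
Proof.
move=> c_gt0 le_ab le_ca; rewrite -(leq_pmul2l c_gt0).
have := leq_mul (leqnn c2) le_ab; have := leq_mul le_ca (leqnn (a + c)).
by rewrite -!mulnn; lia.
Qed.

Lemma geometric_step_ratio (a c c2 c4 : nat) :
    0 < c -> c <= c2 -> c2 <= c4 -> c * c4 <= c2 ^ 2 ->
    c2 * a <= c ^ 2 + c * a ->
  c4 * (a + c) <= c2 ^ 2 + c2 * (a + c).
Proof.
move=> c_gt0 /subnKC <- /subnKC <-.
move: (c2 - c) (c4 - _) => e g; rewrite -!mulnn => le_c le_ca.
have le_eg : c * g <= e * (c + e) by lia.
have le_ea : e * a <= c * c by lia.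
suff: g * (a + c) <= (c + e) * (c + e) by lia.
case: (posnP e) => [e0|e_gt0].
  have -> : g = 0 by apply/eqP; move: le_eg; rewrite e0 mul0n leqn0 muln_eq0 gtn_eqF.
  by [].
(* The chain is [e * g * (a + c) <= g * c * (c + e) <= e * (c + e) ^ 2]. *)
rewrite -(leq_pmul2l e_gt0).
have := leq_mul (leqnn g) le_ea; have := leq_mul le_eg (leqnn (c + e)).
lia.
Qed.

(** * Propagating log-concavity along the alternating string *)

Lemma indep_count_bin (r : nat) (b : nat -> bool) (n i : nat) :
  i <= r -> indep_count r b n i = 'C(n, i).
Proof.
elim: n i => [|n IHn] [|i] //= lt_ir.
by rewrite binS lt_ir orbT mul1n !IHn // ltnW.
Qed.

Lemma indep_count_le_bin (r : nat) (b : nat -> bool) (n i : nat) :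
  indep_count r b n i <= 'C(n, i).
Proof.
elim: n i => [|n IHn] [|i] //=; rewrite binS leq_add //.
by case: (_ || _); rewrite ?mul1n.
Qed.

Lemma indep_count_small (r : nat) (b : nat -> bool) (n i : nat) :
  n <= r -> indep_count r b n i = 'C(n, i).
Proof.
move=> le_nr; case: (leqP i r) => [/indep_count_bin//|lt_ri].
apply/eqP; rewrite eqn_leq indep_count_le_bin bin_small //.
lia.
Qed.

Lemma lc_seq_small (r : nat) (b : nat -> bool) (n : nat) :
  n <= r -> lc_seq (indep_count r b n).
Proof.
move=> le_nr; have [lcb zb] := lc_seq_bin n.
by split=> i; rewrite !indep_count_small //; apply: zb.
Qed.

Lemma lc_seq_dominating (r : nat) (b : nat -> bool) (n : nat) :
    r <= n -> b n -> lc_seq (indep_count r b n) ->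
    'C(n.+1, r) * indep_count r b n r.+2 <= indep_count r b n r.+1 ^ 2 ->
  lc_seq (indep_count r b n.+1).
Proof.
move=> le_rn bn [lcf zf] le_r.
have gE i : r < i -> indep_count r b n.+1 i = indep_count r b n i.
  by case: i => // i; rewrite ltnS /= bn ltnNge => ->; rewrite addn0.
split=> i.
  case: (ltngtP i.+1 r) => [lt_ir|le_ri|eq_ir].
  - by rewrite !indep_count_bin; [apply: (lc_seq_bin _).1|lia..].
  - rewrite (gE i.+1) // (gE i.+2) 1?leqW //; move: le_ri; rewrite ltnS leq_eqVlt.
    by case/predU1P => [<-|/gE->]; [rewrite indep_count_bin|apply: lcf].
  (* With [r] in the middle, only the third entry may fall short of its binomial, which helps. *)
  - rewrite !(@indep_count_bin r b _ i, @indep_count_bin r b _ i.+1) -?eq_ir //.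
    apply: leq_trans ((lc_seq_bin n.+1).1 i).
    by rewrite leq_mul2l indep_count_le_bin orbT.
case: (ltngtP i r) => [lt_ir|lt_ri|->].
- by rewrite !indep_count_bin; [apply: (lc_seq_bin _).2|lia..].
- by rewrite (gE i) // (gE i.+1) 1?leqW //; apply: zf.
- by rewrite indep_count_bin // => /eqP; rewrite -leqn0 leqNgt bin_gt0 leqW.
Qed.

(** A single infinite string, so that induction on the length keeps [b] fixed; the parity of the
    final length goes into [s]. *)
Definition alternating_bit (r : nat) (s : bool) (i : nat) : bool :=
  (r <= i) && (s (+) odd i).

(* [m] is the number of vertices just after the next dominating vertex, or just
   before the next isolated one.  The third conjunct says that [f r.+1 / 'C(m, r)]
   grows over the next isolated-dominating pair of vertices. *)
Lemma alternating_invariant (r : nat) (s : bool) (d : nat) :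
  let b := alternating_bit r s in
  let n := r + d in let m := n + b n in let f := indep_count r b n in
  [/\ lc_seq f, 'C(m, r) * f r.+2 <= f r.+1 ^ 2
    & 'C(m.+2, r) * f r.+1 <= 'C(m, r) ^ 2 + 'C(m, r) * f r.+1].
Proof.
rewrite /=; elim: d => [|d].
  rewrite addn0; split; first exact: lc_seq_small.
    by rewrite !indep_count_small // ['C(r, r.+2)]bin_small ?muln0.
  by rewrite indep_count_small // ['C(r, r.+1)]bin_small ?muln0.
rewrite addnS; move: (leq_addr d r); move: (r + d) => n le_rn.
set b := alternating_bit r s.
have bS : b n.+1 = ~~ b n by rewrite /b /alternating_bit leqW // le_rn /= addbN.
(* A dominating vertex [n] keeps [m] at [n.+1] and the counts above [r] as they were; an isolated
   one moves [m] from [n] to [n.+2]. *)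
case bn: (b n) bS => bS; rewrite bS ?addn1 ?addn0 => -[lcf le1 le2].
  have fE i : r < i -> indep_count r b n.+1 i = indep_count r b n i.
    by case: i => // i; rewrite ltnS /= bn ltnNge => ->; rewrite addn0.
  by split; rewrite ?fE //; apply: lc_seq_dominating.
have fS i : indep_count r b n.+1 i.+1 = indep_count r b n i.+1 + indep_count r b n i.
  by rewrite /= bn mul1n.
have c_gt0 : 0 < 'C(n, r) by rewrite bin_gt0.
split.
- by apply: lc_seq_mul1X lcf => //; case: (n).
- by rewrite !fS [indep_count r b n r]indep_count_bin //; apply: geometric_step_count.
- rewrite !fS [indep_count r b n r]indep_count_bin //.
  by apply: geometric_step_ratio (bin_upper_lc2 n r) le2 => //; apply: leq_bin2l; lia.
Qed.

Lemma lc_seq_alternating (r n : nat) (s : bool) :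
  lc_seq (indep_count r (alternating_bit r s) n).
Proof.
case: (leqP r n) => [/subnKC <-|/ltnW/lc_seq_small//].
by have [] := alternating_invariant r s (n - r).
Qed.

Lemma antiregular_genE (r n : nat) (last : bool) :
  antiregular_gen r.+1 n last =
  string_hypergraph r.+1 [tuple alternating_bit r (last (+) ~~ odd n) i | i < n].
Proof.
rewrite /antiregular_gen; case: ltnP => [lt_nr|_]; last first.
  congr string_hypergraph; apply: eq_from_tnth => i.
  rewrite !tnth_mktuple /alternating_bit ltnS; congr andb.
  by rewrite oddB //= -addbA; case: (odd n); case: (odd i).
(* Fewer than [r.+1] vertices leave no room for a hyperedge. *)
apply/esym/setP => e; rewrite !inE; apply/negP => /andP[/eqP ce _].
by have := max_card (mem e); rewrite ce card_ord leqNgt lt_nr.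
Qed.

Lemma log_concave_antiregular_gen (k n : nat) (last : bool) :
  0 < k -> log_concave (indep_poly (antiregular_gen k n last)).
Proof.
case: k => // r _ [|i] // _ _; rewrite antiregular_genE !coef_indep_poly_string.
by rewrite -natrM -natrX ler_nat; apply: (lc_seq_alternating _ _ _).1.
Qed.

Theorem theorem3p4 (k n : nat) (hk : (3 <= k)%N) (hn : (1 <= n)%N) :
  log_concave (indep_poly (antiregular k n)) /\
  log_concave (indep_poly (antiregular_bar k n)).
Proof. by split; apply: log_concave_antiregular_gen; apply: ltnW (ltnW hk). Qed.
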